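(* Let $\mathbf{S}$ be a semigroup with a two-sided action $(\backslash,/)$ on a set $X$. Put $I[s]=X$ for every $s\in S$, and for all $a,b\in S$ let $\lambda[a,b]\colon X\to X$ be the map $x\mapsto b\backslash x$ and $\rho[a,b]\colon X\to X$ the map $x\mapsto x/a$. Then the resulting system of maps $$\mathcal{S}(X,\mathbf{S},X)=\bigl(\langle\lambda[a,b],\rho[a,b]\rangle\colon I[ab]\to I[a]\times I[b]\bigr)_{(a,b)\in S^2}$$ is a $\lambda\rho$-system over $\mathbf{S}$. Moreover, for any semigroup $\mathbf{H}$, the $\lambda\rho$-product $\mathbf{H}^{[\mathcal{S}(X,\mathbf{S},X)]}$ is isomorphic to the two-sided wreath product $\mathbf{H}\wr(X,\mathbf{S},X)$ of $\mathbf{H}$ by $\mathbf{S}$.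
   Context: Composition of maps is $(g\circ f)(x)=g(f(x))$. A two-sided action of a semigroup $\mathbf{S}$ on a set $X$ is a pair of maps $\backslash\colon S\times X\to X$ and $/\colon X\times S\to X$ satisfying $a\backslash(b\backslash x)=(ab)\backslash x$, $(x/a)/b=x/(ab)$ and $(a\backslash x)/b=a\backslash(x/b)$ for all $a,b\in S$, $x\in X$. The two-sided wreath product $\mathbf{H}\wr(X,\mathbf{S},X)$ is the semigroup on $H^X\times S$ with multiplication $(u,a)\star(w,b)=\bigl((u\circ(x\mapsto b\backslash x))\cdot(w\circ(x\mapsto x/a)),\,ab\bigr)$, where $\cdot$ is the pointwise product in $H^X$. A $\lambda\rho$-system over a semigroup $\mathbf{S}$ is a family of sets $(I[s])_{s\in S}$ together with, for every $(a,b)\in S^2$, maps $\lambda[a,b]\colon I[ab]\to I[a]$ and $\rho[a,b]\colon I[ab]\to I[b]$ such that for all $a,b,c\in S$: ($\alpha$) $\lambda[a,b]\circ\lambda[ab,c]=\lambda[a,bc]$; ($\beta$) $\rho[b,c]\circ\rho[a,bc]=\rho[ab,c]$; ($\gamma$) $\rho[a,b]\circ\lambda[ab,c]=\lambda[b,c]\circ\rho[a,bc]$. For a semigroup $\mathbf{H}$, the $\lambda\rho$-product $\mathbf{H}^{[\mathcal{S}]}$ has universe $\{(x,a): a\in S,\ x\in H^{I[a]}\}$, where $H^{I[a]}$ is the set of all maps $I[a]\to H$, and operation $(x,a)\star(y,b)=\bigl((x\circ\lambda[a,b])\cdot(y\circ\rho[a,b]),\,ab\bigr)$, with $\cdot$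 computed pointwise in $H^{I[ab]}$. *)

(* Defs.v *)
From HB Require Import structures.
From mathcomp Require Import all_boot.
From mathcomp Require Import boolp.

Set Implicit Arguments.
Unset Strict Implicit.
Unset Printing Implicit Defensive.

Local Open Scope group_scope.

(* [semigroupType] includes a choice structure on the carrier.  This is no
   restriction classically: [boolp.gen_choiceMixin] equips any type with one. *)

(* [lact A a x] is a \ x and [ract A x a] is x / a. *)
Record two_sided_action (S : semigroupType) (X : Type) := TwoSidedAction {
  lact : S -> X -> X;
  ract : X -> S -> X;
  lactM : forall a b x, lact a (lact b x) = lact (a * b) x;
  ractM : forall a b x, ract (ract x a) b = ract x (a * b);
  lractA : forall a b x, ract (lact a x) b = lact a (ract x b)
}.

Definition wreath (H S : semigroupType) (X : Type)
  (A : two_sided_action S X) : Type := ((X -> H) * S)%type.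

Definition wreath_mul (H S : semigroupType) (X : Type)
    (A : two_sided_action S X) (p q : wreath H A) : wreath H A :=
  (mul_fun (p.1 \o (fun x => lact A q.2 x)) (q.1 \o (fun x => ract A x p.2)),
   p.2 * q.2).

Lemma wreath_mulA (H S : semigroupType) (X : Type) (A : two_sided_action S X) :
  associative (@wreath_mul H S X A).
Proof.
move=> [u a] [v b] [w c]; rewrite /wreath_mul /=; congr pair; last exact: mulgA.
by apply: funext => x /=; rewrite lactM lractA ractM mulgA.
Qed.

HB.instance Definition _ (H S : semigroupType) (X : Type)
  (A : two_sided_action S X) := gen_eqMixin (wreath H A).
HB.instance Definition _ (H S : semigroupType) (X : Type)
  (A : two_sided_action S X) := gen_choiceMixin (wreath H A).
HB.instance Definition _ (H S : semigroupType) (X : Type)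
  (A : two_sided_action S X) :=
  isSemigroup.Build (wreath H A) (@wreath_mulA H S X A).

(* A family of sets with maps lambda[a, b] and rho[a, b] of the right types,
   not yet subject to any identity. *)
Record lr_family (S : semigroupType) := LRFamily {
  lr_set : S -> Type;
  lr_lambda : forall a b, lr_set (a * b) -> lr_set a;
  lr_rho : forall a b, lr_set (a * b) -> lr_set b
}.
Arguments lr_lambda {S} F a b _ : rename.
Arguments lr_rho {S} F a b _ : rename.

(* The identities are between maps with domain I[abc]; since I[a(bc)] and
   I[(ab)c] are distinct types, [lr_assoc] is the transport along
   associativity, which identifies them. *)
Definition lr_assoc (S : semigroupType) (I : S -> Type) (a b c : S)
    (x : I (a * (b * c))) : I (a * b * c) :=
  ecast s (I s) (mulgA a b c) x.

Arguments lr_assoc {S} I a b c x.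

Record is_lr_system (S : semigroupType) (F : lr_family S) : Prop :=
    IsLRSystem {
  lr_alpha : forall a b c,
    lr_lambda F a b \o lr_lambda F (a * b) c \o lr_assoc (lr_set F) a b c
      =1 lr_lambda F a (b * c);
  lr_beta : forall a b c,
    lr_rho F b c \o lr_rho F a (b * c)
      =1 lr_rho F (a * b) c \o lr_assoc (lr_set F) a b c;
  lr_gamma : forall a b c,
    lr_rho F a b \o lr_lambda F (a * b) c \o lr_assoc (lr_set F) a b c
      =1 lr_lambda F b c \o lr_rho F a (b * c)
}.

(* The pair (x, a) with x : I[a] -> H is encoded as [existT _ a x]. *)
Definition lr_product (H S : semigroupType) (F : lr_family S) : Type :=
  {a : S & lr_set F a -> H}.

Definition lr_product_mul (H S : semigroupType) (F : lr_family S)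
    (p q : lr_product H F) : lr_product H F :=
  let: existT a x := p in
  let: existT b y := q in
  existT _ (a * b)
    (mul_fun (x \o lr_lambda F a b) (y \o lr_rho F a b)).

HB.instance Definition _ (H S : semigroupType) (F : lr_family S) :=
  hasMul.Build (lr_product H F) (@lr_product_mul H S F).

(* The operation makes sense over any family; over a lambda-rho-system it is
   associative. *)
Lemma lr_product_mulA (H S : semigroupType) (F : lr_family S) :
  is_lr_system F -> associative (@mul (lr_product H F)).
Proof.
move=> sysF [a x] [b y] [c z]; rewrite /mul /=.
have -> (g : lr_set F (a * b * c) -> H) :
    existT (fun s => lr_set F s -> H) (a * b * c) g =
    existT (fun s => lr_set F s -> H) (a * (b * c))
      (g \o lr_assoc (lr_set F) a b c).
  by rewrite /lr_assoc; move: g; case: _ / (mulgA a b c).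
congr existT; apply: funext => t /=.
have /= <- := lr_alpha sysF t; have /= <- := lr_gamma sysF t.
by have /= -> := lr_beta sysF t; rewrite mulgA.
Qed.

Definition lr_of_action (S : semigroupType) (X : Type)
    (A : two_sided_action S X) : lr_family S :=
  @LRFamily S (fun _ => X) (fun a b x => lact A b x) (fun a b x => ract A x a).

(* Main.v *)
Require Import Defs.
From HB Require Import structures.
From mathcomp Require Import all_boot.

(** Each of the three identities of a lambda-rho-system, read on the constant
    family [X], is one of the three axioms of a two-sided action: alpha is
    [lactM], beta is [ractM] and gamma is [lractA].  The transport along
    associativity is invisible, because the family of sets is constant
    ([lr_assoc_const]).  For the same reason a dependent pair [(x, a)] with
    [x : I[a] -> H] is an ordinary pair in [(X -> H) * S], and after this
    relabelling the two multiplications are given by the same formula. *)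

(** Associativity in [S] is only a propositional equality, so this needs
    elimination of the equality proof. *)
Lemma lr_assoc_const (S : semigroupType) (X : Type) (a b c : S) (x : X) :
  lr_assoc (fun _ : S => X) a b c x = x.
Proof. by rewrite /lr_assoc; case: _ / (mulgA a b c). Qed.

Lemma lr_of_action_system (S : semigroupType) (X : Type)
    (A : two_sided_action S X) :
  is_lr_system (lr_of_action A).
Proof.
split=> a b c x /=; rewrite ?lr_assoc_const.
- exact: lactM.
- exact: ractM.
- exact: lractA.
Qed.

Section WreathOfProduct.

Variables (H S : semigroupType) (X : Type) (A : two_sided_action S X).

Definition wreath_of_lr (p : lr_product H (lr_of_action A)) : wreath H A :=
  (projT2 p, projT1 p).

Definition lr_of_wreath (q : wreath H A) : lr_product H (lr_of_action A) :=
  existT (fun a => lr_set (lr_of_action A) a -> H) q.2 q.1.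

Lemma wreath_of_lr_bij : bijective wreath_of_lr.
Proof. by exists lr_of_wreath; case. Qed.

Lemma wreath_of_lrM : {morph wreath_of_lr : p q / (p * q)%g >-> (p * q)%g}.
Proof. by move=> [a x] [b y]. Qed.

HB.instance Definition _ :=
  isMultiplicative.Build (lr_product H (lr_of_action A)) (wreath H A)
    wreath_of_lr wreath_of_lrM.

End WreathOfProduct.

Theorem proposition3 (S : semigroupType) (X : Type)
    (A : two_sided_action S X) :
  is_lr_system (lr_of_action A) /\
  forall H : semigroupType,
    exists f : {multiplicative lr_product H (lr_of_action A) -> wreath H A},
      bijective f.
Proof.
split=> [|H]; first exact: lr_of_action_system.
by exists (@wreath_of_lr H S X A); apply: wreath_of_lr_bij.
Qed.
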